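(* Let $(W,\Sigma)$ be a Coxeter system, $Q=(\sigma_1,\ldots,\sigma_n)$ a word in $W$, $\pi$ an element of $W$ such that $Q$ contains $\pi$, and let $\Delta$ be the subword complex $\Delta(Q,\pi)$. Let $k$ be a field and $R=k[x_1,\ldots,x_n]$. Then $$\mathrm{proj\,dim}_R(I_{\Delta^\vee})\le n-\ell(\pi).$$
   Context: $\Sigma$ is the set of simple reflections of the Coxeter group $W$ and $\ell$ the length function. A word $Q=(\sigma_1,\ldots,\sigma_n)$ of size $n$ is an ordered sequence of elements of $\Sigma$; a subword $P=(\sigma_{i_1},\ldots,\sigma_{i_m})$, $i_1<\cdots<i_m$, is an ordered subsequence (identified with its set of positions). $P$ represents $\pi$ if the ordered product of the simple reflections in $P$ is a reduced expression for $\pi$; $P$ contains $\pi$ if some subsequence of $P$ represents $\pi$. The subword complex $\Delta(Q,\pi)$ is the set of subwords $Q\setminus P$ such that $P$ contains $\pi$; it is a pure simplicial complex whose facets are the $Q\setminus P$ with $P$ representing $\pi$. For $P=(\sigma_{i_1},\ldots,\sigma_{i_m})$ put $\mathbf x_P=x_{i_1}\cdots x_{i_m}$. The Stanley--Reisner ideal of the Alexander dual of $\Delta$ is $I_{\Delta^\vee}=(\mathbf x_P: P\subseteq Q,\ P\text{ represents }\pi)\subset R$. *)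

(* Defs.v *)
From HB Require Import structures.
From mathcomp Require Import all_boot all_algebra.
From mathcomp Require Import boolp.
From mathcomp Require Import mpoly.

Set Implicit Arguments.
Unset Strict Implicit.
Unset Printing Implicit Defensive.

Import GRing.Theory.
Local Open Scope ring_scope.

Section Coxeter.
Variable W : groupType.
Implicit Types (Sigma : W -> Prop) (w : W).

(* Elements of the free group on [Sigma]: words in signed letters, where
   [(s, true)] stands for the generator [s] and [(s, false)] for its formal
   inverse, taken up to free cancellation. *)
Definition signed_word := seq (W * bool).

Definition signed_word_over Sigma (u : signed_word) : Prop :=
  forall a, a \in u -> Sigma a.1.

Definition signed_eval (u : signed_word) : W :=
  (\big[*%g/1]_(a <- u) (if a.2 then a.1 else a.1^-1))%g.

(* Equality in the group presented by the generators [Sigma] and the relators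
   [rel]. *)
Inductive presented_eq Sigma (rel : signed_word -> Prop) :
    signed_word -> signed_word -> Prop :=
| PresRefl u : presented_eq Sigma rel u u
| PresSym u v : presented_eq Sigma rel u v -> presented_eq Sigma rel v u
| PresTrans u v t : presented_eq Sigma rel u v -> presented_eq Sigma rel v t ->
    presented_eq Sigma rel u t
| PresCancel u s b v : Sigma s ->
    presented_eq Sigma rel (u ++ [:: (s, b); (s, ~~ b)] ++ v) (u ++ v)
| PresRelator u r v : rel r -> presented_eq Sigma rel (u ++ r ++ v) (u ++ v).

Definition is_presentation Sigma (rel : signed_word -> Prop) : Prop :=
  (forall w, exists2 u, signed_word_over Sigma u & signed_eval u = w) /\
  (forall u v, signed_word_over Sigma u -> signed_word_over Sigma v ->
     (signed_eval u = signed_eval v <-> presented_eq Sigma rel u v)).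

(* The value [0] encodes the entry [oo] of a Coxeter matrix. *)
Definition is_coxeter_matrix Sigma (m : W -> W -> nat) : Prop :=
  [/\ forall s, Sigma s -> m s s = 1%N,
      forall s t, Sigma s -> Sigma t -> m s t = m t s
    & forall s t, Sigma s -> Sigma t -> s <> t -> m s t <> 1%N].

Definition coxeter_relators Sigma (m : W -> W -> nat) : signed_word -> Prop :=
  fun r => exists s t, [/\ Sigma s, Sigma t, m s t <> 0%N
    & r = flatten (nseq (m s t) [:: (s, true); (t, true)])].

(* [Sigma] may be infinite. *)
Definition coxeter_system Sigma : Prop :=
  exists2 m, is_coxeter_matrix Sigma m
           & is_presentation Sigma (coxeter_relators Sigma m).

Definition word_over Sigma (u : seq W) : Prop := forall s, s \in u -> Sigma s.

Definition word_prod (u : seq W) : W := (\big[*%g/1]_(s <- u) s)%g.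

Definition has_word_of_size Sigma w (l : nat) : Prop :=
  exists u, [/\ word_over Sigma u, size u = l & word_prod u = w].

(* The length function; the junk value [0] is only taken at elements which are
   not products of elements of [Sigma]. *)
Definition coxeter_length Sigma w : nat :=
  match pselect (exists l, `[< has_word_of_size Sigma w l >]) with
  | left wP => ex_minn wP
  | right _ => 0%N
  end.

Section Subwords.
Variables (Sigma : W -> Prop) (n : nat) (Q : n.-tuple W).
Implicit Types (P : {set 'I_n}) (p : W).

(* A subword is given by its set of positions; [enum P] is increasing. *)
Definition subword P : seq W := [seq tnth Q i | i <- enum P].

Definition represents P p : bool :=
  (word_prod (subword P) == p) && (size (subword P) == coxeter_length Sigma p).

Definition contains P p : bool :=
  [exists P' : {set 'I_n}, (P' \subset P) && represents P' p].

Definition subword_complex p : {set {set 'I_n}} :=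
  [set ~: P | P in [set P | contains P p]].

End Subwords.
End Coxeter.

(* Simplicial complexes on the vertex set ['I_n] are given by their faces. *)
Definition alexander_dual n (D : {set {set 'I_n}}) : {set {set 'I_n}} :=
  [set F | ~: F \notin D].

Section Ideals.
Variable A : comNzRingType.

Definition ideal_gen (G : A -> Prop) : {pred A^o} :=
  fun x => `[< exists2 s : seq (A * A),
    (forall a, a \in s -> G a.2) & x = \sum_(a <- s) a.1 * a.2 >].

Lemma ideal_gen_submod (G : A -> Prop) : submod_closed (ideal_gen G).
Proof.
split=> [|c x y /asboolP[s sG ->] /asboolP[t tG ->]]; apply/asboolP.
  by exists [::] => //; rewrite big_nil.
exists ([seq (c * a.1, a.2) | a <- s] ++ t).
  by move=> a; rewrite mem_cat => /orP[/mapP[b /sG Gb ->]|/tG].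
rewrite big_cat big_map /=; congr (_ + _).
by rewrite [LHS]mulr_sumr; apply: eq_bigr => a _; rewrite mulrA.
Qed.

HB.instance Definition _ (G : A -> Prop) :=
  GRing.isSubmodClosed.Build A A^o (ideal_gen G) (ideal_gen_submod G).

(* The ideal generated by [G], as an [A]-module. *)
Record ideal (G : A -> Prop) :=
  Ideal { ideal_val : A^o; _ : ideal_val \in ideal_gen G }.

HB.instance Definition _ (G : A -> Prop) := [isSub for @ideal_val G].
HB.instance Definition _ (G : A -> Prop) := [Choice of ideal G by <:].
HB.instance Definition _ (G : A -> Prop) :=
  [SubChoice_isSubLmodule of ideal G by <:].

End Ideals.

Section ProjectiveDimension.
Variable A : nzRingType.

Definition projective (P : lmodType A) : Prop :=
  forall (M N : lmodType A) (g : {linear M -> N}) (f : {linear P -> N}),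
    (forall y, exists x, g x = y) ->
    exists h : {linear P -> M}, forall x, g (h x) = f x.

(* ... -> P 2 -> P 1 -> P 0 -> M -> 0 is exact, with all P i projective *)
Definition projective_resolution (M : lmodType A) (P : nat -> lmodType A)
    (d : forall i, {linear P i.+1 -> P i}) (e : {linear P 0%N -> M}) : Prop :=
  [/\ forall i, projective (P i),
      forall y, exists x, e x = y,
      forall x, e x = 0 <-> exists y, d 0%N y = x
    & forall i x, d i x = 0 <-> exists y, d i.+1 y = x].

(* The projective dimension of [M], the infimum of the lengths of its
   projective resolutions, is at most [l]. *)
Definition projdim_le (M : lmodType A) (l : nat) : Prop :=
  exists (P : nat -> lmodType A) (d : forall i, {linear P i.+1 -> P i})
         (e : {linear P 0%N -> M}),
    projective_resolution d e /\ forall i, (l < i)%N -> forall x : P i, x = 0.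

End ProjectiveDimension.

Section StanleyReisner.
Variables (k : fieldType) (n : nat).

Definition sqfree_monomial (P : {set 'I_n}) : {mpoly k[n]} := \prod_(i in P) 'X_i.

Definition stanley_reisner_gens (D : {set {set 'I_n}}) : {mpoly k[n]} -> Prop :=
  fun f => exists2 F : {set 'I_n}, F \notin D & f = sqfree_monomial F.

Definition stanley_reisner_ideal (D : {set {set 'I_n}}) : lmodType {mpoly k[n]} :=
  ideal (stanley_reisner_gens D).

End StanleyReisner.

Arguments stanley_reisner_gens k n D _ : clear implicits.

Lemma nonface_dual_subword_complex (W : groupType) (Sigma : W -> Prop) n
    (Q : n.-tuple W) (p : W) (F : {set 'I_n}) :
  (F \notin alexander_dual (subword_complex Sigma Q p)) = contains Sigma Q F p.
Proof.
rewrite inE negbK; apply/imsetP/idP => [[P]|FP].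
  by rewrite inE => PP /(congr1 (@setC _)); rewrite !setCK => ->.
by exists F; rewrite ?inE.
Qed.

(* For the Alexander dual of a subword complex, the Stanley-Reisner ideal is the
   ideal generated by the x_P with P representing p. *)
Lemma stanley_reisner_dual_subword (k : fieldType) (W : groupType)
    (Sigma : W -> Prop) n (Q : n.-tuple W) (p : W) :
  ideal_gen (stanley_reisner_gens k n (alexander_dual (subword_complex Sigma Q p)))
  =i ideal_gen (fun f : {mpoly k[n]} =>
       exists2 P : {set 'I_n}, represents Sigma Q P p & f = sqfree_monomial k P).
Proof.
move=> x; apply/asboolP/asboolP => -[s sG ->] {x}.
  elim: s sG => [_|a s IHs sG]; first by exists [::].
  have [|t tG et] := IHs; first by move=> b bs; apply: sG; rewrite inE bs orbT.
  have [F] := sG a (mem_head _ _).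
  rewrite nonface_dual_subword_complex => /existsP[P /andP[PF Pp]] aF.
  exists ((a.1 * sqfree_monomial k (F :\: P), sqfree_monomial k P) :: t).
    move=> b; rewrite inE => /orP[/eqP->|/tG//].
    by exists P.
  rewrite !big_cons et /= aF; congr (_ + _).
  rewrite -mulrA; congr (_ * _).
  by rewrite /sqfree_monomial (big_setID P) /= (setIidPr PF) mulrC.
exists s => // a /sG[P Pp ->]; exists P => //.
rewrite nonface_dual_subword_complex; apply/existsP; exists P.
by rewrite subxx.
Qed.

(* Main.v *)
From HB Require Import structures.
Require Import Defs.
From mathcomp Require Import all_boot all_algebra.
From mathcomp Require Import boolp.
From mathcomp Require Import mpoly zify.

(* Write [Q = (s, Q')] and [I(Q, p)] for the ideal of the [x_P] with [P]
   representing [p]. If [l(s p) > l(p)], then [I(Q, p) = I(Q', p)]. Otherwise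
   [I(Q, p) = x_1 J + K] with [J = I(Q', s p)] and [K = I(Q', p)]; the exchange
   property gives [K <= J], and no generator of [K] involves [x_1], so there is
   an exact sequence [0 -> K -> J + K -> I(Q, p) -> 0] (direct sum). By
   induction on [n], [pd J <= n - l(p)] and [pd K <= n - l(p) - 1], whence
   [pd I(Q, p) <= n - l(p)]. *)

Set Implicit Arguments.
Unset Strict Implicit.
Unset Printing Implicit Defensive.

Import GRing.Theory.

(** * Projective dimension by syzygies *)

Section Modules.
Local Open Scope ring_scope.
Variable A : nzRingType.
Implicit Types M N P B C K L X : lmodType A.

Lemma ex_linear M N (f : M -> N) :
  linear f -> exists g : {linear M -> N}, g =1 f.
Proof.
move=> flin; pose fL := GRing.isLinear.Build A M N *:%R f flin.
by exists (HB.pack f fL : {linear M -> N}).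
Qed.

(** Injectivity makes preimages under [i] unique, so choosing one for each [f x] is automatically
    linear. Maps into kernels and ideals are all built this way. *)
Lemma ex_lift_injective M N X (i : {linear M -> N}) (f : {linear X -> N}) :
    injective i -> (forall x, exists y, i y = f x) ->
  exists h : {linear X -> M}, forall x, i (h x) = f x.
Proof.
move=> iI fi; pose h x := sval (cid (fi x)).
have ih x : i (h x) = f x by rewrite /h; case: cid.
have [g gE] : exists g : {linear X -> M}, g =1 h.
  by apply: ex_linear => c x y; apply: iI; rewrite linearP !ih linearP.
by exists g => x; rewrite gE.
Qed.

Section Kernel.
Variables (M N : lmodType A) (f : {linear M -> N}).

Definition ker_pred : {pred M} := fun x => f x == 0.

Lemma ker_pred_submod : submod_closed ker_pred.
Proof.
split=> [|c x y]; rewrite !unfold_in /ker_pred ?linear0// linearP.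
by move=> /eqP-> /eqP->; rewrite scaler0 addr0.
Qed.

HB.instance Definition _ :=
  GRing.isSubmodClosed.Build A M ker_pred ker_pred_submod.

Record ker := Ker { ker_val : M; _ : ker_val \in ker_pred }.

HB.instance Definition _ := [isSub for ker_val].
HB.instance Definition _ := [Choice of ker by <:].
HB.instance Definition _ := [SubChoice_isSubLmodule of ker by <:].

End Kernel.

Lemma ex_kernel M N (f : {linear M -> N}) :
  exists (K : lmodType A) (i : {linear K -> M}),
    injective i /\ forall x, f x = 0 <-> exists y, i y = x.
Proof.
exists (ker f), (val : {linear ker f -> M}); split; first exact: val_inj.
move=> x; split=> [/eqP fx|[[y /eqP fy] <-//]].
by exists (Ker (fx : x \in ker_pred f)).
Qed.

Definition exact_at M N C (i : {linear M -> N}) (q : {linear N -> C}) :=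
  forall x, q x = 0 <-> exists y, i y = x.

Definition surj M N (q : {linear M -> N}) := forall y, exists x, q x = y.

Lemma injective_linear M N (f : {linear M -> N}) :
  (forall x, f x = 0 -> x = 0) -> injective f.
Proof.
move=> f0 x y fxy; apply/eqP; rewrite -subr_eq0; apply/eqP/f0.
by rewrite linearB fxy subrr.
Qed.

Definition zero_module M := forall x : M, x = 0.

Lemma zero_module_projective M : zero_module M -> projective M.
Proof.
move=> M0 X Y g f _; exists (\0 : {linear M -> X}) => x.
by rewrite (M0 x) !linear0.
Qed.

Lemma projective_prod M N :
  projective M -> projective N -> projective (M * N)%type.
Proof.
move=> prM prN X Y g f gS.
have [fM fME] : exists h : {linear M -> Y}, h =1 (fun x => f (x, 0)).
  by apply: ex_linear => c x y; rewrite -linearP; congr (f (_, _));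
    rewrite /= scaler0 addr0.
have [fN fNE] : exists h : {linear N -> Y}, h =1 (fun x => f (0, x)).
  by apply: ex_linear => c x y; rewrite -linearP; congr (f (_, _));
    rewrite /= scaler0 addr0.
have [hM hME] := prM _ _ g fM gS.
have [hN hNE] := prN _ _ g fN gS.
have [h hE] : exists h : {linear (M * N)%type -> X},
    h =1 (fun x => hM x.1 + hN x.2).
  by apply: ex_linear => c x y /=; rewrite !linearP scalerDr addrACA.
exists h => x; rewrite hE linearD hME hNE fME fNE -linearD; congr (f _).
by case: x => x y; congr (_, _); rewrite /= ?addr0 ?add0r.
Qed.

(** Projectivity of [C] gives a section [s] of [q], and [b - s (q b)] lies in the image of [i]. Thus
    [B] splits as [M] plus [C], and lifts are found on each summand. *)
Lemma projective_extension M B C (i : {linear M -> B}) (q : {linear B -> C}) :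
    injective i -> exact_at i q -> surj q -> projective M -> projective C ->
  projective B.
Proof.
move=> iI ex qS prM prC X Y g f gS.
have [s sE] := prC _ _ q idfun qS.
have [t tE] : exists t : {linear B -> B}, t =1 (fun b => b - s (q b)).
  apply: ex_linear => c x y.
  by rewrite scalerBr [q _]linearP [s _]linearP opprD addrACA.
have [|r rE] := ex_lift_injective (f := t) iI.
  by move=> x; apply/ex; rewrite tE linearB sE subrr.
have [hM hME] := prM _ _ g (f \o i) gS.
have [hC hCE] := prC _ _ g (f \o s) gS.
have [h hE] : exists h : {linear B -> X}, h =1 (fun x => hM (r x) + hC (q x)).
  by apply: ex_linear => c x y /=; rewrite !linearP scalerDr addrACA.
exists h => x; rewrite hE linearD hME hCE /= rE tE -linearD; congr (f _).
by rewrite subrK.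
Qed.

(** Projective dimension through first syzygies: some syzygy [K] of [M] has dimension at most one
    less. This form allows induction on [l], which whole resolutions do not offer directly. *)
Fixpoint pd_le l M : Prop :=
  if l is l'.+1 then
    exists (P K : lmodType A) (i : {linear K -> P}) (e : {linear P -> M}),
      [/\ projective P, injective i, exact_at i e, surj e & pd_le l' K]
  else projective M.

Lemma ex_zero_module : exists Z : lmodType A, zero_module Z.
Proof. by exists 'rV[A]_0 => x; rewrite (thinmx0 x). Qed.

Lemma pd_le_succ l M : pd_le l M -> pd_le l.+1 M.
Proof.
elim: l M => [|l IHl] M.
  move=> prM; have [Z Z0] := ex_zero_module.
  exists M, Z, \0, idfun; split=> //.
  - by move=> x y _; rewrite (Z0 x) (Z0 y).
  - by move=> x; split=> [/= ->|[y <-//]]; exists 0.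
  - by move=> x; exists x.
  - exact: zero_module_projective.
by move=> [P [K [i [e [prP iI ex eS /IHl pdK]]]]]; exists P, K, i, e.
Qed.

Lemma pd_le_trans l m M : (l <= m)%N -> pd_le l M -> pd_le m M.
Proof. by move=> /subnK<- pdM; elim: (m - l)%N => //= k; apply: pd_le_succ. Qed.

Lemma zero_module_pd_le l M : zero_module M -> pd_le l M.
Proof.
by move=> M0; apply: (@pd_le_trans 0) => //; apply: zero_module_projective.
Qed.

(** A resolution of the syzygy [K], shifted by one degree, is spliced to [P -> M] along [i \o e'];
    injectivity of [i] keeps the kernel that of [e']. *)
Lemma pd_le_projdim l M : pd_le l M -> projdim_le M l.
Proof.
elim: l M => [|l IHl] M.
  move=> prM; have [Z Z0] := ex_zero_module.
  pose P i := if i is 0%N then M else Z.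
  exists P, (fun i => \0 : {linear P i.+1 -> P i}), idfun; split; last first.
    by case.
  split=> //.
  - by case=> //= i; apply: zero_module_projective.
  - by move=> x; exists x.
  - by move=> x; split=> [/= ->|[y <-//]]; exists 0.
  - by move=> i x; split=> // _; exists 0; rewrite linear0 [RHS]Z0.
move=> [P [K [i [e [prP iI ex eS /IHl]]]]].
move=> [P' [d' [e' [[prP' e'S ex0 ex'] vanish]]]].
pose PP j := if j is j'.+1 then P' j' else P.
pose dd j : {linear PP j.+1 -> PP j} :=
  match j with 0%N => i \o e' | j'.+1 => d' j' end.
exists PP, dd, e; split; last by case=> [//|j]; exact: vanish.
split=> //; first by case.
  move=> x; rewrite ex; split=> -[y <-].
    by have [z <-] := e'S y; exists z.
  by exists (e' y).
case=> [|j] x /=; last exact: ex'.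
rewrite -ex0 /=; split=> [ix0|-> //]; last by rewrite linear0.
by apply: iI; rewrite linear0.
Qed.

(** Horseshoe lemma: covers [P] of [M] and [P'] of [C] combine to a cover of [B] by [P * P'], and
    the syzygies form an exact sequence [0 -> K -> L -> K' -> 0], to which induction applies. *)
Lemma pd_le_extension l M B C (i : {linear M -> B}) (q : {linear B -> C}) :
    injective i -> exact_at i q -> surj q -> pd_le l M -> pd_le l C ->
  pd_le l B.
Proof.
elim: l M B C i q => [|l IHl] M B C i q iI ex qS.
  exact: projective_extension ex qS.
move=> [P [K [j [e [prP jI exP eS pdK]]]]].
move=> [P' [K' [j' [e' [prP' j'I exP' e'S pdK']]]]].
(* Projectivity of [P'] lifts [e'] through [q]; this gives the second component of the cover of
   [B]. *)
have [s sE] := prP' _ _ q e' qS.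
have [f fE] : exists f : {linear (P * P')%type -> B},
    f =1 (fun x => i (e x.1) + s x.2).
  by apply: ex_linear => c x y /=; rewrite !linearP scalerDr addrACA.
have [L [k [kI exk]]] := ex_kernel f.
exists (P * P')%type, L, k, f; split=> //.
- exact: projective_prod.
- move=> b; have [x' x'E] := e'S (q b).
  have /ex[m mE] : q (b - s x') = 0 by rewrite linearB sE x'E subrr.
  have [x xE] := eS m.
  by exists (x, x'); rewrite fE /= xE mE subrK.
have qi m : q (i m) = 0 by apply/ex; exists m.
have [u0 u0E] : exists u0 : {linear K -> (P * P')%type},
    u0 =1 (fun x => (j x, 0)).
  by apply: ex_linear => c x y; rewrite linearP; congr (_, _);
    rewrite /= scaler0 addr0.
have [|u uE] := ex_lift_injective (f := u0) kI.
  move=> x; apply/exk; rewrite u0E fE /= linear0 addr0.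
  have -> : e (j x) = 0 by apply/exP; exists x.
  by rewrite linear0.
have fk y : f (k y) = 0 by apply/exk; exists y.
have [v0 v0E] : exists v0 : {linear L -> P'}, v0 =1 (fun x => (k x).2).
  by apply: ex_linear => c x y; rewrite linearP.
have [|v vE] := ex_lift_injective (f := v0) j'I.
  move=> x; apply/exP'; rewrite v0E -sE.
  by have := congr1 q (fk x); rewrite fE linearD qi add0r linear0.
apply: (IHl K L K' u v) => //.
- move=> x y /(congr1 k); rewrite !uE !u0E => -[]; exact: jI.
- move=> x; split=> [vx|[y <-]]; last first.
    by apply: j'I; rewrite vE v0E uE u0E linear0.
  have k2 : (k x).2 = 0 by rewrite -v0E -vE vx linear0.
  have : e (k x).1 = 0.
    by apply: iI; rewrite linear0; have := fk x; rewrite fE k2 linear0 addr0.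
  move=> /exP[y yE]; exists y; apply: kI; rewrite uE u0E yE -k2.
  by case: (k x).
(* Surjectivity of [v]: the image of [j' y] in [B] comes from [M], hence from some [x] in [P], and
   [- x] corrects the pair into an element of [L]. *)
- move=> y; have /ex[m mE] : q (s (j' y)) = 0.
    by rewrite sE; apply/exP'; exists y.
  have [x xE] := eS m.
  have /exk[z zE] : f (- x, j' y) = 0.
    by rewrite fE /= !linearN xE mE addNr.
  by exists z; apply: j'I; rewrite vE v0E zE.
Qed.

(** An isomorphism exhibits [N] as an extension of the zero module by [M]. *)
Lemma pd_le_iso l M N (f : {linear M -> N}) :
  injective f -> surj f -> pd_le l M -> pd_le l N.
Proof.
move=> fI fS pdM; have [Z Z0] := ex_zero_module.
apply: (@pd_le_extension l M N Z f \0) => //.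
- by move=> y; exists 0; rewrite linear0 (Z0 y).
- exact: zero_module_pd_le.
Qed.

Lemma pd_le_prod l M N : pd_le l M -> pd_le l N -> pd_le l (M * N)%type.
Proof.
move=> pdM pdN.
have [i iE] : exists i : {linear M -> (M * N)%type}, i =1 (fun x => (x, 0)).
  by apply: ex_linear => c x y; congr (_, _); rewrite /= scaler0 addr0.
have [q qE] : exists q : {linear (M * N)%type -> N}, q =1 snd.
  exact: ex_linear.
apply: (@pd_le_extension l M _ N i q) => //.
- by move=> x y; rewrite !iE => -[].
- move=> [x y]; rewrite qE /=; split=> [->|[z]].
    by exists x; rewrite iE.
  by rewrite iE => -[].
- by move=> y; exists (0, y); rewrite qE.
Qed.

(** Composing a cover [P] of [B] with [q] gives a cover of [M]. Its kernel [L] is an extension of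
    [K] by the syzygy [B1] of [B], both of dimension at most [l]. *)
Lemma pd_le_quotient l K B M (i : {linear K -> B}) (q : {linear B -> M}) :
    injective i -> exact_at i q -> surj q -> pd_le l K -> pd_le l.+1 B ->
  pd_le l.+1 M.
Proof.
move=> iI ex qS pdK [P [B1 [j [e [prP jI exP eS pdB1]]]]].
have [L [k [kI exk]]] := ex_kernel (q \o e).
exists P, L, k, (q \o e); split=> //.
  by move=> y; have [x <-] := qS y; have [z <-] := eS x; exists z.
have [|u uE] := ex_lift_injective (f := j) kI.
  move=> x; apply/exk => /=; have -> : e (j x) = 0 by apply/exP; exists x.
  by rewrite linear0.
have [|v vE] := ex_lift_injective (f := e \o k) iI.
  by move=> x; apply/ex; apply/exk; exists x.
apply: (@pd_le_extension l B1 L K u v) => //.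
- by move=> x y /(congr1 k); rewrite !uE; apply: jI.
- move=> x; split=> [vx|[y <-]]; last first.
    by apply: iI; rewrite vE /= uE linear0; apply/exP; exists y.
  have /exP[y yE] : e (k x) = 0 by have := vE x; rewrite vx linear0.
  by exists y; apply: kI; rewrite uE.
- move=> y; have [x xE] := eS (i y).
  have /exk[z zE] : (q \o e) x = 0 by rewrite /= xE; apply/ex; exists y.
  by exists z; apply: iI; rewrite vE /= zE.
Qed.

End Modules.

(** * Squarefree monomial ideals *)

Section Ideals.
Local Open Scope ring_scope.

(** Different generating families give different types even for equal ideals; the two embeddings
    into [A] induce an isomorphism between them. *)
Lemma pd_le_ideal_eq (A : comNzRingType) (G G' : A -> Prop) l :
  ideal_gen G =i ideal_gen G' -> pd_le l (ideal G) -> pd_le l (ideal G').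
Proof.
move=> GG'.
have [|f fE] := ex_lift_injective (i := val : {linear ideal G' -> A^o})
    (f := val : {linear ideal G -> A^o}) val_inj.
  by move=> [x Gx] /=; have Gx' := Gx; rewrite GG' in Gx'; exists (Ideal Gx').
apply: (pd_le_iso (f := f)).
  by move=> x y /(congr1 val); rewrite !fE => /val_inj.
move=> [y Gy]; have Gy' := Gy; rewrite -GG' in Gy'; exists (Ideal Gy').
by apply: val_inj; rewrite fE.
Qed.

(** Such an ideal is free on its element 1, so a lift is fixed by a preimage [x] of the image of
    1. *)
Lemma projective_unit_ideal (A : comNzRingType) (G : A -> Prop) :
  1 \in ideal_gen G -> projective (ideal G).
Proof.
move=> G1 X Y g f gS; have [x gx] := gS (f (Ideal G1)).
have [h hE] : exists h : {linear ideal G -> X},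
    h =1 (fun y => ideal_val y *: x).
  by apply: ex_linear => c y z; rewrite scalerA -scalerDl.
exists h => y; rewrite hE linearZ gx -linearZ; congr (f _).
by apply: val_inj; rewrite /= [LHS]mulr1.
Qed.

End Ideals.

Section SquareFreeIdeals.
Local Open Scope ring_scope.
Variables (k : fieldType) (n : nat).
Local Notation R := {mpoly k[n]}.
Implicit Types (G : {set 'I_n} -> Prop) (P : {set 'I_n}).

Definition sqfree_gens G : R -> Prop :=
  fun f => exists2 P, G P & f = sqfree_monomial k P.

Definition sqfree_mnm P : 'X_{1..n} := [multinom (i \in P : nat) | i < n].

Lemma sqfree_monomialE P : sqfree_monomial k P = 'X_[sqfree_mnm P].
Proof.
rewrite mpolyXE_id /sqfree_monomial big_mkcond /=; apply: eq_bigr => i _.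
by rewrite mnmE; case: (i \in P).
Qed.

(** Membership in a monomial ideal is tested monomial by monomial, by divisibility by a generator.
    This turns inclusions of ideals into statements on sets of positions. *)
Lemma sqfree_idealP G (f : R) :
  f \in ideal_gen (sqfree_gens G) <->
  forall m, m \in msupp f -> exists2 P, G P & forall i, i \in P -> (0 < m i)%N.
Proof.
split=> [/asboolP[s sG ->] {f}|suppG].
  elim: s sG => [_ m|a s IHs sG m]; first by rewrite big_nil msupp0.
  rewrite big_cons => /msuppD_le; rewrite mem_cat => /orP[|ms]; last first.
    by apply: IHs => // b bs; apply: sG; rewrite inE bs orbT.
  have [P GP ->] := sG a (mem_head _ _).
  rewrite sqfree_monomialE (perm_mem (msuppMX _ _)) => /mapP[m' _ ->].
  by exists P => // i iP; rewrite mnmDE mnmE iP.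
rewrite [f]mpolyE big_seq.
apply: (rpred_sum (S := ideal_gen (sqfree_gens G))) => m /suppG[P GP Pm].
apply/asboolP; exists [:: (f@_m *: 'X_[m - sqfree_mnm P], 'X_[sqfree_mnm P])].
  by move=> a; rewrite inE => /eqP->; exists P; rewrite ?sqfree_monomialE.
rewrite big_seq1 /= -scalerAl -mpolyXD submK//.
by apply/mnm_lepP => i; rewrite mnmE; case: (boolP (i \in P)) => // /Pm.
Qed.

(* [x_i J + K] is the cokernel of [K -> J + K], [y |-> (y, - x_i y)], because
   [x_i] is a nonzerodivisor modulo [K]. *)
Lemma pd_le_sqfree_step (GI GJ GK : {set 'I_n} -> Prop) (i : 'I_n) d :
    (forall P, GK P -> i \notin P) ->
    (forall P, GK P -> exists2 P' : {set 'I_n}, GJ P' & P' \subset P) ->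
    (forall P, GK P -> GI P) ->
    (forall P, GJ P -> GI (i |: P)) ->
    (forall P, GI P ->
      GK P \/ exists2 P' : {set 'I_n}, GJ P' & P = i |: P' /\ i \notin P') ->
    pd_le d (ideal (sqfree_gens GJ)) ->
    zero_module (ideal (sqfree_gens GK)) \/
      (exists2 d', d = d'.+1 & pd_le d' (ideal (sqfree_gens GK))) ->
  pd_le d (ideal (sqfree_gens GI)).
Proof.
move=> GKi GKJ GKI GJI GI_KJ pdJ pdK.
set I := ideal (sqfree_gens GI); set J := ideal (sqfree_gens GJ) in pdJ *.
set K := ideal (sqfree_gens GK) in pdK *.
have mem_KJ (f : R) : f \in ideal_gen (sqfree_gens GK) ->
    f \in ideal_gen (sqfree_gens GJ).
  move=> /sqfree_idealP fK; apply/sqfree_idealP => m.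
  move=> /fK[P /GKJ[P' GP' /subsetP sP] Pm].
  by exists P' => // j /sP /Pm.
have suppX (f : R) m :
    (m \in msupp ('X_i * f)) = (m \in [seq (U_(i) + m')%MM | m' <- msupp f]).
  by rewrite mulrC (perm_mem (msuppMX _ _)).
(* As no generator of [K] involves ['X_i], multiplying a monomial by ['X_i] does not affect its
   divisibility by them. *)
have mem_colon (f : R) : 'X_i * f \in ideal_gen (sqfree_gens GK) ->
    f \in ideal_gen (sqfree_gens GK).
  move=> /sqfree_idealP fK; apply/sqfree_idealP => m fm.
  have [|P GP Pm] := fK (U_(i) + m)%MM; first by rewrite suppX map_f.
  exists P => // j jP; have := Pm j jP; rewrite mnmDE mnm1E.
  by case: eqP jP => // <- /(negP (GKi _ GP)).
have memI (f g : R) : f \in ideal_gen (sqfree_gens GJ) ->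
    g \in ideal_gen (sqfree_gens GK) ->
    'X_i * f + g \in ideal_gen (sqfree_gens GI).
  move=> /sqfree_idealP fJ /sqfree_idealP gK; apply/sqfree_idealP => m.
  move=> /msuppD_le; rewrite mem_cat => /orP[|/gK[P GP Pm]];
    last by exists P; auto.
  rewrite suppX => /mapP[m' /fJ[P GP Pm] ->]; exists (i |: P); first exact: GJI.
  move=> j; rewrite mnmDE mnm1E inE in_set1 => /orP[/eqP->|/Pm m'j].
    by rewrite eqxx.
  by rewrite addn_gt0 m'j orbT.
have [q0 q0E] : exists q0 : {linear (J * K)%type -> R^o},
    q0 =1 (fun x => ('X_i : R) * ideal_val x.1 + ideal_val x.2).
  apply: ex_linear => c x y; rewrite [ideal_val _.1](linearP val).
  rewrite [ideal_val _.2](linearP val) scalerDr mulrDr addrACA.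
  congr (_ + _ + _).
  exact: mulrCA.
have [|q qE] := ex_lift_injective (i := val : {linear I -> R^o})
    (f := q0) val_inj.
  by move=> [[f fJ] [g gK]]; exists (Ideal (memI _ _ fJ gK)); rewrite q0E.
have [|u uE] := ex_lift_injective (i := val : {linear J -> R^o})
    (f := val : {linear K -> R^o}) val_inj.
  by move=> [f fK]; exists (Ideal (mem_KJ _ fK)).
have [i1 i1E] : exists i1 : {linear K -> (J * K)%type},
    i1 =1 (fun y => (u y, - (('X_i : R) *: y))).
  apply: ex_linear => c x y; congr (_, _); first exact: linearP.
  by rewrite /= scalerDr opprD scalerN !scalerA mulrC.
have i1I : injective i1.
  by move=> x y; rewrite !i1E => -[/(congr1 val) + _]; rewrite !uE => /val_inj.
(* If ['X_i * f + g = 0], then ['X_i * f] lies in [K], hence so does [f], and [(f, g)] is the image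
   of [f]. *)
have ex : exact_at i1 q.
  move=> [[f fJ] [g gK]]; split.
    move=> /(congr1 val); rewrite qE q0E /= => /eqP.
    rewrite addr_eq0 => /eqP fg.
    have fK : f \in ideal_gen (sqfree_gens GK).
      apply: mem_colon; rewrite fg.
      by rewrite (rpredN (ideal_gen (sqfree_gens GK)) g).
    exists (Ideal fK); rewrite i1E; congr (_, _); apply: val_inj;
      rewrite ?uE //=.
    by rewrite [_ *: _]fg opprK.
  move=> [y]; rewrite i1E => yE; apply: val_inj; rewrite qE q0E -yE /=.
  by rewrite -[ideal_val (u y)]/(val (u y)) uE /= [_ *: _]/(_ * _) subrr.
have qS : surj q.
  suff spanI (f : R) : f \in ideal_gen (sqfree_gens GI) ->
      exists x, ideal_val (q x) = f.
    by move=> [f fI]; have [x xE] := spanI f fI; exists x; apply: val_inj.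
  move=> /asboolP[s sG ->] {f}; elim: s sG => [_|a s IHs sG].
    by exists 0; rewrite linear0 big_nil.
  have [|y yE] := IHs; first by move=> b bs; apply: sG; rewrite inE bs orbT.
  rewrite big_cons -yE.
  suff [x xE] : exists x, ideal_val (q x) = a.2.
    by exists (a.1 *: x + y); rewrite linearP /= xE; congr (_ + _).
  have [P /GI_KJ[GP ->|[P' GP' [-> iP']] ->]] := sG a (mem_head _ _).
    have Pm : sqfree_monomial k P \in ideal_gen (sqfree_gens GK).
      apply/asboolP; exists [:: (1, sqfree_monomial k P)].
        by move=> b; rewrite inE => /eqP->; exists P.
      by rewrite big_seq1 mul1r.
    exists (0, Ideal Pm); rewrite -[ideal_val _]/(val _) qE q0E /=.
    by rewrite mulr0 add0r.
  have Pm : sqfree_monomial k P' \in ideal_gen (sqfree_gens GJ).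
    apply/asboolP; exists [:: (1, sqfree_monomial k P')].
      by move=> b; rewrite inE => /eqP->; exists P'.
    by rewrite big_seq1 mul1r.
  exists (Ideal Pm, 0); rewrite -[ideal_val _]/(val _) qE q0E /= addr0.
  by rewrite /sqfree_monomial big_setU1.
(* If [K] is zero, [q] is an isomorphism; otherwise the quotient bound applies with [d = d'.+1]. *)
case: pdK => [K0|[d' dE pdK]].
  apply: (pd_le_iso (f := q)) => //;
    last exact: pd_le_prod (zero_module_pd_le _ K0).
  apply: injective_linear => x /ex[y <-].
  by rewrite (K0 y) linear0.
rewrite dE in pdJ *; have pdJK := pd_le_prod pdJ (pd_le_succ pdK).
exact: (pd_le_quotient i1I ex qS pdK pdJK).
Qed.

End SquareFreeIdeals.

(** * The exchange property of Coxeter groups *)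

Section Coxeter.
Variables (W : groupType) (Sigma : W -> Prop).
Hypothesis WSigma : coxeter_system Sigma.
Implicit Types (s t w x : W) (u v : seq W) (a : W * bool).

Local Open Scope group_scope.

Definition letter a : W := if a.2 then a.1 else a.1^-1.

Lemma signed_eval_cons a (U : signed_word W) :
  signed_eval (a :: U) = letter a * signed_eval U.
Proof. by rewrite /signed_eval big_cons. Qed.

Lemma signed_eval_cat (U V : signed_word W) :
  signed_eval (U ++ V) = signed_eval U * signed_eval V.
Proof. by rewrite /signed_eval big_cat. Qed.

Lemma word_prod_cons s u : word_prod (s :: u) = s * word_prod u.
Proof. by rewrite /word_prod big_cons. Qed.

Lemma word_prod_nil : word_prod [::] = 1 :> W.
Proof. by rewrite /word_prod big_nil. Qed.

(* The parity of the number of [i] such that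
   [t = s_1 ... s_(i-1) s_i s_(i-1) ... s_1], for [U = s_1 ... s_l]. *)
Fixpoint reflection_parity (U : signed_word W) t : bool :=
  if U is a :: V then (t == a.1) (+) reflection_parity V (t ^ letter a)
  else false.

(** Cocycle rule: the reflections contributed by [V] in [U ++ V] are those of [V] conjugated by the
    value of [U]. *)
Lemma reflection_parity_cat U V t :
  reflection_parity (U ++ V) t =
  reflection_parity U t (+) reflection_parity V (t ^ signed_eval U).
Proof.
elim: U t => [|a U IHU] t /=; first by rewrite /signed_eval big_nil conjg1.
by rewrite IHU signed_eval_cons conjgM addbA.
Qed.

Lemma relator_eval m r :
    is_presentation Sigma (coxeter_relators Sigma m) ->
    coxeter_relators Sigma m r ->
  signed_eval r = 1.
Proof.
move=> [_ presP] rR; have rS : signed_word_over Sigma r.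
  case: rR => s [t [sS tS _ ->]] a /flattenP[b].
  by rewrite mem_nseq => /andP[_ /eqP->]; rewrite !inE => /orP[]/eqP->.
have -> : 1 = signed_eval [::] :> W by rewrite /signed_eval big_nil.
apply/presP => //; rewrite -[r in presented_eq _ _ r]cats0.
by apply: (@PresRelator _ _ _ [::]).
Qed.

Lemma involution s : Sigma s -> s * s = 1.
Proof.
move=> sS; have [m [m1 _ _] presm] := WSigma.
have : signed_eval [:: (s, true); (s, true)] = 1.
  by apply: (relator_eval presm); exists s, s; rewrite m1.
by rewrite !signed_eval_cons /signed_eval big_nil mulg1.
Qed.

Lemma invg_gen s : Sigma s -> s^-1 = s.
Proof. by move=> /involution; apply: mulg1_eq. Qed.

(** The successive reflections of the word [s t s t ...] of [k.*2] letters are [s], [s t s],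
    [s t s t s], and so on. *)
Lemma alternating_parity s t k x : Sigma s -> Sigma t ->
  reflection_parity (flatten (nseq k [:: (s, true); (t, true)])) x =
  \big[addb/false]_(0 <= i < k.*2) (x == (s * t) ^+ i * s).
Proof.
move=> sS tS; elim: k x => [|k IHk] x /=; first by rewrite big_nil.
rewrite IHk doubleS !big_nat_recl//= /letter /= expg0 mul1g expg1.
congr (_ (+) (_ (+) _)).
  by rewrite -(inj_eq (conjg_inj s^-1)) conjgK conjgE invgK invg_gen // mulgA.
apply: eq_bigr => i _.
rewrite -conjgM -(inj_eq (conjg_inj (s * t)^-1)) conjgK conjgE invgK invgM.
by rewrite !invg_gen // expgS expgSr -!mulgA.
Qed.

(** Since [(s * t) ^+ m s t = 1], the list of [2 m s t] reflections is one list of [m s t] terms run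
    through twice, so the parities cancel. *)
Lemma relator_parity m r x :
    is_presentation Sigma (coxeter_relators Sigma m) ->
    coxeter_relators Sigma m r ->
  reflection_parity r x = false.
Proof.
move=> presm rR; have := relator_eval presm rR.
case: rR => s [t [sS tS _ ->]]; rewrite alternating_parity//.
have -> j :
    signed_eval (flatten (nseq j [:: (s, true); (t, true)])) = (s * t) ^+ j.
  elim: j => [|j IHj]; first by rewrite /signed_eval big_nil.
  by rewrite /= !signed_eval_cons IHj expgS mulgA.
move=> st1; rewrite -addnn (big_cat_nat (n := m s t)) ?leq_addr//=.
rewrite -{2}[m s t]add0n big_addn addnK.
under [X in _ (+) X]eq_bigr do rewrite expgnDr st1 mulg1.
exact: addbb.
Qed.

(** Each move inserts or removes a word of value 1 whose reflections cancel modulo 2; by the cocycle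
    rule the rest is unaffected. Hence the parity is an invariant of the group element. *)
Lemma presented_eq_parity m U V :
    is_presentation Sigma (coxeter_relators Sigma m) ->
    presented_eq Sigma (coxeter_relators Sigma m) U V ->
  signed_eval U = signed_eval V /\ reflection_parity U =1 reflection_parity V.
Proof.
move=> presm; elim=> {U V}
  [//|U V _ [eUV pUV]|U V T _ [eUV pUV] _ [eVT pVT]|U s b V sS|U r V rR].
- by split=> // x; rewrite pUV.
- by split=> [|x]; rewrite ?eUV ?pUV.
- have e1 : signed_eval [:: (s, b); (s, ~~ b)] = 1.
    rewrite !signed_eval_cons /signed_eval big_nil mulg1 /letter.
    by case: b; rewrite /= ?mulgV ?mulVg.
  split=> [|x]; first by rewrite !signed_eval_cat e1 mul1g.
  rewrite !reflection_parity_cat e1 conjg1; congr (_ (+) _).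
  rewrite -[RHS]addFb; congr (_ (+) _) => /=; rewrite addbF.
  have ss : s ^ letter (s, b) = s.
    by rewrite /letter conjgE; case: (b);
      rewrite /= ?mulKg // mulgV mulg1 invgK.
  by rewrite -[X in _ ^ letter _ == X]ss (inj_eq (@conjg_inj _ _)) addbb.
- have e1 := relator_eval presm rR.
  split=> [|x]; first by rewrite !signed_eval_cat e1 mul1g.
  by rewrite !reflection_parity_cat e1 conjg1 (relator_parity _ presm rR).
Qed.

Definition positive_word u : signed_word W := [seq (s, true) | s <- u].

Lemma positive_word_eval u : signed_eval (positive_word u) = word_prod u.
Proof. by rewrite /signed_eval big_map. Qed.

Lemma word_parity_eq u v :
    word_over Sigma u -> word_over Sigma v -> word_prod u = word_prod v ->
  reflection_parity (positive_word u) =1 reflection_parity (positive_word v).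
Proof.
have [m _ presm] := WSigma; move=> uS vS uv.
have pS (w' : seq W) :
    word_over Sigma w' -> signed_word_over Sigma (positive_word w').
  by move=> wS a /mapP[s /wS sS ->].
have [_ /(_ _ _ (pS _ uS) (pS _ vS))[+ _]] := presm.
rewrite !positive_word_eval => /(_ uv) /(presented_eq_parity presm).
by case.
Qed.

Lemma word_over_cons s u :
  word_over Sigma (s :: u) <-> Sigma s /\ word_over Sigma u.
Proof.
split=> [suS|[sS uS] t].
  by split=> [|t tu]; apply: suS; rewrite inE ?eqxx ?tu ?orbT.
by rewrite inE => /orP[/eqP->|/uS].
Qed.

(** Odd parity forces [t] to occur as [s_1 ... s_j ... s_1] for some letter of [u], and left
    multiplication by this reflection deletes that letter. *)
Lemma parity_deletion u t : word_over Sigma u ->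
    reflection_parity (positive_word u) t ->
  exists2 j, (j < size u)%N &
    t * word_prod u = word_prod (take j u ++ drop j.+1 u).
Proof.
elim: u t => [//|s u IHu] t /word_over_cons[sS uS] /=.
case: eqP => [-> _|_ /=].
  by exists 0%N; rewrite // take0 /= drop0 word_prod_cons mulgA
       involution// mul1g.
move=> /(IHu _ uS)[j ju jE]; exists j.+1 => //=.
by rewrite !word_prod_cons -jE /letter /= conjgE !mulgA mulgV mul1g.
Qed.

Lemma length_spec w :
  has_word_of_size Sigma w (coxeter_length Sigma w) /\
  forall l, has_word_of_size Sigma w l -> (coxeter_length Sigma w <= l)%N.
Proof.
have wP : exists l, `[< has_word_of_size Sigma w l >].
  have [m _ [gen _]] := WSigma; have [U US <-] := gen w.
  exists (size U); apply/asboolP; exists [seq a.1 | a <- U]; split.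
  - by move=> s /mapP[a /US aS ->].
  - by rewrite size_map.
  - rewrite /word_prod big_map /signed_eval [LHS]big_seq [RHS]big_seq.
    by apply: eq_bigr => -[s []] /US //= sS; rewrite invg_gen.
rewrite /coxeter_length; case: pselect => // wP'.
by case: ex_minnP => l /asboolP lP lmin; split=> // l' l'P; apply/lmin/asboolP.
Qed.

Lemma ex_reduced_word w : exists u,
  [/\ word_over Sigma u, size u = coxeter_length Sigma w & word_prod u = w].
Proof. by have [] := length_spec w. Qed.

Lemma length_le u : word_over Sigma u ->
  (coxeter_length Sigma (word_prod u) <= size u)%N.
Proof. by move=> uS; have [_] := length_spec (word_prod u); apply; exists u. Qed.

Lemma length_mul_le s w : Sigma s ->
  (coxeter_length Sigma (s * w) <= (coxeter_length Sigma w).+1)%N.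
Proof.
move=> sS; have [u [uS <- <-]] := ex_reduced_word w.
by rewrite -word_prod_cons; apply: (@length_le (s :: u)); apply/word_over_cons.
Qed.

Lemma mul_genK s w : Sigma s -> s * (s * w) = w.
Proof. by move=> sS; rewrite mulgA involution// mul1g. Qed.

Lemma length_descent s w : Sigma s ->
    (coxeter_length Sigma (s * w) < coxeter_length Sigma w)%N ->
  coxeter_length Sigma w = (coxeter_length Sigma (s * w)).+1.
Proof.
move=> sS sw; apply/eqP; rewrite eqn_leq sw andbT.
by rewrite -{1}(mul_genK w sS) length_mul_le.
Qed.

(* Let [v] be reduced for [s w]. The reflection [s] does not occur in [v], since
   otherwise [w] would have a word shorter than [v]; hence it occurs an odd
   number of times in [s :: v], and so in [u]. *)
Lemma exchange s u : Sigma s -> word_over Sigma u ->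
    (coxeter_length Sigma (s * word_prod u) <
      coxeter_length Sigma (word_prod u))%N ->
  exists2 j, (j < size u)%N &
    s * word_prod u = word_prod (take j u ++ drop j.+1 u).
Proof.
move=> sS uS su; apply: parity_deletion => //.
have [v [vS vsize vE]] := ex_reduced_word (s * word_prod u).
have svS : word_over Sigma (s :: v) by apply/word_over_cons.
rewrite (word_parity_eq uS svS); last by rewrite word_prod_cons vE mul_genK.
rewrite /= eqxx /= /letter /= conjgE mulKg.
apply/negP => /(parity_deletion vS)[j jv].
rewrite vE mul_genK// => uE; move: su; rewrite -vsize uE ltnNge => /negP; apply.
apply: leq_trans (length_le _) _.
  by move=> x; rewrite mem_cat => /orP[/mem_take|/mem_drop]; apply: vS.
by rewrite size_cat size_takel 1?ltnW// size_drop; lia.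
Qed.

End Coxeter.

(** * Ideals of subwords *)

Section OrdinalSets.
Variable n : nat.
Implicit Types (P : {set 'I_n}) (i : 'I_n).

Lemma sorted_enum P : sorted (fun i j : 'I_n => (i < j)%N) (enum P).
Proof.
rewrite /enum_mem -enumT; apply: sorted_filter.
  by move=> x y z; apply: ltn_trans.
by have := iota_ltn_sorted 0 n; rewrite -val_enum_ord sorted_map.
Qed.

(** Both sides are strictly increasing lists with the same members. Adding a smallest position
    therefore prepends one letter to the subword. *)
Lemma enum_setU1_min i P : (forall j, j \in P -> (i < j)%N) ->
  enum (i |: P) = i :: enum P.
Proof.
move=> iP; apply: (irr_sorted_eq (leT := fun i j : 'I_n => (i < j)%N)).
- by move=> x y z; apply: ltn_trans.
- by move=> x; apply: ltnn.
- exact: sorted_enum.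
- rewrite /= path_min_sorted ?sorted_enum//.
  by apply/allP => j; rewrite mem_enum => /iP.
- by move=> j; rewrite !inE !mem_enum !inE.
Qed.

(** This translates deletion of a letter, as in the exchange property, into removal of a
    position. *)
Lemma enum_setD1_nth x0 P j : (j < size (enum P))%N ->
  enum (P :\ nth x0 (enum P) j) = take j (enum P) ++ drop j.+1 (enum P).
Proof.
move=> jP; set x := nth _ _ _.
have -> : enum (P :\ x) = [seq y <- enum P | y != x].
  rewrite {1}/enum_mem -filter_predI; apply: eq_filter => y.
  by rewrite /= !inE.
have := enum_uniq (mem P); rewrite -{1 2}(cat_take_drop j (enum P)).
rewrite (drop_nth x0 jP) -/x cat_uniq /= => /and3P[_ + /andP[xd _]].
rewrite negb_or => /andP[xt _].
have filter_id (s : seq 'I_n) : x \notin s -> [seq y <- s | y != x] = s.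
  by move=> xs; apply/all_filterP/allP => y ys; apply: contraNneq xs => <-.
by rewrite filter_cat /= eqxx /= !filter_id.
Qed.

Lemma card_final_segment_le r P :
  (forall i, i \in P -> (n - r <= i)%N) -> (#|P| <= r)%N.
Proof.
move=> Pr; rewrite cardE -(size_map val) -[r in (_ <= r)%N](size_iota (n - r)).
apply: uniq_leq_size.
  by rewrite map_inj_uniq ?enum_uniq//; apply: val_inj.
move=> _ /mapP[i + ->]; rewrite mem_enum mem_iota => /Pr -> /=.
by rewrite -leq_subLR ?(leq_trans _ (ltn_ord i))//; have := ltn_ord i; lia.
Qed.

End OrdinalSets.

Section SubwordIdeals.
Local Open Scope ring_scope.
Variables (W : groupType) (Sigma : W -> Prop).
Hypothesis WSigma : coxeter_system Sigma.
Variables (n : nat) (Q : n.-tuple W).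
Hypothesis Q_word : word_over Sigma Q.
Variable k : fieldType.
Implicit Types (P : {set 'I_n}) (p : W).

Local Notation len := (coxeter_length Sigma).

Lemma tnth_gen i : Sigma (tnth Q i).
Proof. exact/Q_word/mem_tnth. Qed.

Lemma subword_over P : word_over Sigma (subword Q P).
Proof. by move=> s /mapP[i _ ->]; apply: tnth_gen. Qed.

(* The subwords of the last [r] letters of [Q] that represent [p]. *)
Definition suffix_rep r p P : Prop :=
  (forall i, i \in P -> (n - r <= i)%N) /\ represents Sigma Q P p.

(** This yields the inclusion of [K] in [J]: the letter deleted by exchange leaves a word for
    [s * p] with [len p - 1] letters, which is reduced. *)
Lemma exchange_subword s p P : Sigma s -> represents Sigma Q P p ->
    (len (s * p)%g < len p)%N ->
  exists2 P', represents Sigma Q P' (s * p)%g & P' \subset P.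
Proof.
move=> sS /andP[/eqP Pp /eqP Psize] sp.
have [|j ju jE] := exchange WSigma sS (@subword_over P); first by rewrite Pp.
have jP : (j < size (enum P))%N by rewrite size_map in ju.
have x0 : 'I_n by case: (enum P) jP.
exists (P :\ nth x0 (enum P) j); last exact: subsetDl.
have sE : subword Q (P :\ nth x0 (enum P) j) =
    take j (subword Q P) ++ drop j.+1 (subword Q P).
  by rewrite /subword enum_setD1_nth// map_cat map_take map_drop.
rewrite /represents sE -jE Pp eqxx /= size_cat size_takel 1?ltnW// size_drop.
by move: ju; rewrite Psize (length_descent WSigma sS sp) => ju; apply/eqP; lia.
Qed.

(** Induction on the number [r] of final letters. Positions stay in ['I_n], so the polynomial ring
    is the same throughout. *)
Lemma pd_le_suffix_ideal r p : (r <= n)%N ->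
  pd_le (r - len p) (ideal (@sqfree_gens k n (suffix_rep r p))).
Proof.
elim: r p => [|r IHr] p rn.
  have len1 : len 1%g = 0%N.
    have := @length_le _ _ WSigma [::].
    by rewrite word_prod_nil leqn0 => /(_ _)/eqP->.
  have suff0 P : suffix_rep 0 p P -> P = set0.
    move=> [P0 _]; apply/setP => i; rewrite inE; apply/negP => /P0.
    by rewrite subn0 leqNgt ltn_ord.
  have sub0 : subword Q set0 = [::] by rewrite /subword enum_set0.
  (* Only the empty subword is available: the ideal is zero if [p] is not 1, and contains the empty
     monomial 1 otherwise. *)
  have [p1|p1] := eqVneq p 1%g; last first.
    apply: zero_module_pd_le => -[f fI]; apply: val_inj => /=.
    move: fI => /asboolP[[|a s] sG ->]; first by rewrite big_nil.
    have [P GP _] := sG a (mem_head _ _); have P0 := suff0 P GP.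
    case: GP => _; rewrite /represents P0 sub0 word_prod_nil.
    by rewrite eq_sym (negbTE p1).
  apply: (@pd_le_trans _ 0) => //; apply: projective_unit_ideal.
  apply/asboolP; exists [:: (1, sqfree_monomial k set0)].
    move=> a; rewrite inE => /eqP-> /=; exists set0 => //; split.
      by move=> i; rewrite inE.
    by rewrite /represents sub0 word_prod_nil p1 len1 !eqxx.
  by rewrite big_seq1 /= /sqfree_monomial big_set0 mulr1.
have i0n : (n - r.+1 < n)%N by lia.
pose i0 := Ordinal i0n; pose s := tnth Q i0.
have sS : Sigma s := tnth_gen i0.
have i0_min P : (forall i, i \in P -> (n - r <= i)%N) ->
    forall i, i \in P -> (i0 < i)%N.
  by move=> Pr i /Pr /=; lia.
have subU P : (forall i, i \in P -> (n - r <= i)%N) ->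
    subword Q (i0 |: P) = s :: subword Q P.
  by move=> Pr; rewrite /subword enum_setU1_min//; apply: i0_min.
have widen P : suffix_rep r p P -> suffix_rep r.+1 p P.
  by move=> [Pr Pp]; split=> // i /Pr; lia.
(* A representing subword avoids the first available letter [s], or starts with it; the remainder
   then has product [s * p] and [len p - 1] letters. *)
have split_rep P : suffix_rep r.+1 p P -> suffix_rep r p P \/
    exists P' : {set 'I_n}, [/\ P = i0 |: P', i0 \notin P',
      forall i, i \in P' -> (n - r <= i)%N,
      word_prod (subword Q P') = (s * p)%g & (size (subword Q P')).+1 = len p].
  move=> [Pr Pp]; have nri i : i \in P -> i != i0 -> (n - r <= i)%N.
    by move=> /Pr; rewrite -val_eqE /=; lia.
  have [i0P|i0P] := boolP (i0 \in P); last first.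
    left; split=> // i iP; apply: nri => //.
    by apply: contraNneq i0P => <-.
  have P'r i : i \in P :\ i0 -> (n - r <= i)%N.
    by rewrite !inE => /andP[ii0 iP]; apply: nri.
  right; exists (P :\ i0); rewrite setD1K// !inE eqxx /=; split=> //.
    move: Pp; rewrite /represents -{1}(setD1K i0P) subU// word_prod_cons.
    by move=> /andP[/eqP <- _]; rewrite (mul_genK WSigma).
  by move: Pp => /andP[_ /eqP<-]; rewrite -{2}(setD1K i0P) subU.
(* Without a descent, [s * p] has no word of [len p - 1] letters, so only the first alternative of
   [split_rep] survives. *)
have [sp|sp] := ltnP (len (s * p)%g) (len p); last first.
  have -> : suffix_rep r.+1 p = suffix_rep r p.
    apply/funext => P; apply/propext; split; last exact: widen.
    move=> /split_rep[//|[P' [_ _ _ P'p P'size]]].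
    have := length_le WSigma (@subword_over P'); rewrite P'p; lia.
  by apply: (pd_le_trans _ (IHr p (ltnW rn))); lia.
have lenp := length_descent WSigma sS sp.
apply: (@pd_le_sqfree_step _ _ _ (suffix_rep r (s * p)%g) (suffix_rep r p) i0).
- by move=> P [/i0_min Pr _]; apply/negP => /Pr; rewrite ltnn.
- move=> P [Pr Pp]; have [P' P'p P'P] := exchange_subword sS Pp sp.
  by exists P' => //; split=> // i /(subsetP P'P)/Pr.
- exact: widen.
- move=> P [Pr /andP[/eqP Pp /eqP Psize]]; split.
    by move=> i; rewrite !inE => /orP[/eqP-> //|/Pr]; lia.
  rewrite /represents subU// word_prod_cons Pp (mul_genK WSigma)// eqxx /=.
  by rewrite Psize lenp.
- move=> P /split_rep[|[P' [-> i0P' P'r P'p P'size]]]; [by left|right].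
  exists P' => //; split=> //; rewrite /represents P'p eqxx /=.
  by rewrite lenp in P'size; case: P'size => ->.
- by rewrite lenp subSS; apply: IHr; apply: ltnW.
(* Subtraction is truncated, so [r - len p] is one less than the bound for [r.+1] only if
   [len p <= r]. Otherwise [r] letters are too few to represent [p] and [K] is zero. *)
have [pr|rp] := leqP (len p) r; [right|left].
  by exists (r - len p)%N; [lia|apply: IHr; apply: ltnW].
move=> [f fI]; apply: val_inj => /=.
move: fI => /asboolP[[|a t] tG ->]; first by rewrite big_nil.
have [P [Pr /andP[_ /eqP Psize]] _] := tG a (mem_head _ _).
have := card_final_segment_le Pr.
by rewrite cardE -(size_map (tnth Q)) -/(subword Q P) Psize leqNgt rp.
Qed.

End SubwordIdeals.

Theorem theorem4p1p14 (W : groupType) (Sigma : W -> Prop)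
    (WSigma : coxeter_system Sigma)
    (n : nat) (Q : n.-tuple W) (Q_word : word_over Sigma Q)
    (p : W) (Q_contains_p : contains Sigma Q [set: 'I_n] p)
    (k : fieldType) :
  projdim_le
    (stanley_reisner_ideal k (alexander_dual (subword_complex Sigma Q p)))
    (n - coxeter_length Sigma p).
Proof.
apply: pd_le_projdim.
(* For [r = n] every position of [Q] is allowed. *)
apply: pd_le_ideal_eq (pd_le_suffix_ideal WSigma Q_word k p (leqnn n)) => f.
rewrite stanley_reisner_dual_subword; congr (f \in ideal_gen _).
apply/funext => g; apply/propext; split=> -[P GP ->]; exists P => //.
  by case: GP.
by split=> // i _; rewrite subnn.
Qed.
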